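(* Let $n$ be a nonnegative integer, let $A_n=\sum_{k=0}^n\binom nk^2\binom{n+k}k^2$ and $\beta_n=\sum_{k=0}^{n}\binom{n}{k}^2\binom{n+k}{k}$. If $A_n\equiv 16k+8j+4i+1\pmod{32}$ and $\beta_n\equiv 4m+2l+1\pmod 8$ with $i,j,k,l,m\in\{0,1\}$, then \[L_2(n)\equiv 4(k+m)+2j+i\pmod 8.\]
   Context: $L_2(n)$, the binary run-length of $n$, is the number of blocks of consecutive $0$'s and of consecutive $1$'s in the binary expansion of $n$ (with $L_2(0)=0$). Equivalently, $L_2(0)=0$ and for $n\ge1$, $L_2(n)=L_2(\lfloor n/2\rfloor)$ if $n\equiv0,3\pmod4$ and $L_2(n)=L_2(\lfloor n/2\rfloor)+1$ if $n\equiv1,2\pmod4$. *)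

(* Defs.v *)
From mathcomp Require Import all_boot.

Set Implicit Arguments.
Unset Strict Implicit.
Unset Printing Implicit Defensive.

(* Binary expansion, least significant digit first (the number of blocks does
   not depend on the reading direction). There is no leading zero, because
   up_log 2 n.+1 is the bit length of n; in particular bits 0 = [::]. *)
Definition bits (n : nat) : bitseq :=
  mkseq (fun i => odd (n %/ 2 ^ i)) (up_log 2 n.+1).

(* The maximal blocks of equal consecutive digits. The blocks of a runs value
   are never empty, so the default value of head is irrelevant. *)
Fixpoint runs (s : bitseq) : seq bitseq :=
  if s is b :: s' then
    if runs s' is r :: rs then
      if head b r == b then (b :: r) :: rs else [:: b] :: r :: rs
    else [:: [:: b]]
  else [::].

Definition L2 (n : nat) : nat := size (runs (bits n)).

Definition A (n : nat) : nat :=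
  \sum_(0 <= k < n.+1) 'C(n, k) ^ 2 * 'C(n + k, k) ^ 2.

Definition beta (n : nat) : nat :=
  \sum_(0 <= k < n.+1) 'C(n, k) ^ 2 * 'C(n + k, k).

(* Main.v *)
Require Import Defs.
From mathcomp Require Import all_boot.
From mathcomp Require Import zify ring.

Set Implicit Arguments.
Unset Strict Implicit.
Unset Printing Implicit Defensive.

(* Put t(n,k) = 'C(n, k) 'C(n + k, k) = 'C(n + k, 2k) 'C(2k, k), so that A_n is
   the sum of the t(n,k)^2 and beta_n that of the 'C(n, k) t(n,k). As 'C(2k, k)
   is divisible by 2^s, with s the number of binary digits 1 of k, few residues
   matter. Comparing t(n,2k) with t(n/2,k) and t(n,4k+1) with t(n/4,k), while
   the t(n,4k+3) with k > 0 vanish, gives (quotients rounded down)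
     A_n = A_(n/2) + 4 [n = 1, 2 mod 4] A_(n/4)                         mod 32,
     beta_n = beta_(n/2) + 2 [n = 1 mod 4] beta_(n/4)
              + 4 [n = 1, 2 mod 4, n/4 odd]                             mod 8.
   By induction there is X, depending on n, with A_n = 1 + 4 L + 16 X mod 32
   and beta_n = 1 + 2 [L = 1, 2 mod 4] + 4 X mod 8, where L = L2 n; eliminating
   X yields the theorem. *)

(** * Run-length recursion on the lowest binary digit *)

Lemma bits_cons (b : bool) q : 0 < b + q.*2 -> bits (b + q.*2) = b :: bits q.
Proof.
move=> n_gt0; rewrite /bits up_log2S // half_bit_double.
rewrite /mkseq -[iota 0 _.+1]/(0 :: iota 1 _) /= (iotaDl 1 0) -map_comp.
congr (_ :: _); first by rewrite divn1 oddD odd_double addbF oddb.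
apply: eq_map => i /=; rewrite expnS divnMA.
by congr (odd (_ %/ _)); lia.
Qed.

(** For empty [s] the default [~~ b] differs from [b], so the first block is counted. *)
Lemma size_runs_cons b s :
  size (runs (b :: s)) = size (runs s) + (b != head (~~ b) s).
Proof.
have headP c t : exists r rs, runs (c :: t) = (c :: r) :: rs.
  rewrite /=; case: (runs t) => [|r rs]; first by exists [::], [::].
  by case: eqP => [_|_]; [exists r, rs | exists [::], (r :: rs)].
case: s => [|c s]; first by case: b.
have [r [rs E]] := headP c s; rewrite [runs (b :: _)]/= -/(runs (c :: s)) E /=.
by rewrite eq_sym; case: eqP => _ /=; rewrite ?addn0 ?addn1.
Qed.

Lemma L2_double (b : bool) q : L2 (b + q.*2) = L2 q + (b != odd q).
Proof.
case: (posnP (b + q.*2)) => [n0|n_gt0]; first by case: b q n0 => [|] [|].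
rewrite /L2 bits_cons // size_runs_cons; congr (_ + ~~ (b == _)).
case: (posnP q) n_gt0 => [->|q_gt0 _]; first by case: b.
have Eq : q = odd q + q./2.*2 by rewrite odd_double_half.
by rewrite {1}Eq bits_cons -?Eq.
Qed.

(** * Central binomial coefficients and the terms t(n,k) *)

Lemma central_bin_half k : 'C(k.+1.*2, k.+1) = 2 * 'C(k.*2.+1, k).
Proof.
have := mul_bin_diag k.*2.+2 k; have := mul_bin_down k.*2.+1 k.
rewrite -!pred_Sn doubleS (_ : k.*2.+1 - k = k.+1); last by lia.
move=> _ h; apply/eqP; rewrite -(eqn_pmul2l (ltn0Sn k)) -h; apply/eqP; lia.
Qed.

Lemma central_binS k : k.+1 * 'C(k.+1.*2, k.+1) = 2 * (k.*2.+1 * 'C(k.*2, k)).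
Proof.
rewrite central_bin_half mulnCA (mul_bin_down k.*2.+1 k).
by congr (_ * (_ * _)); lia.
Qed.

(* Written so that the central binomial coefficient, with as many factors 2 as
   k has binary digits 1, splits off. *)
Definition apery_term n k := 'C(n + k, k.*2) * 'C(k.*2, k).

Lemma bin_mul_apery_term n k : 'C(n, k) * 'C(n + k, k) = apery_term n k.
Proof.
rewrite /apery_term.
case: (leqP k n) => [le_kn|lt_nk]; last first.
  by rewrite bin_small // [in RHS]bin_small //; lia.
apply/eqP; rewrite -(@eqn_pmul2r (k`! * (k`! * (n - k)`!)) _ _) ?muln_gt0 ?fact_gt0 //.
have := bin_fact le_kn; have := bin_fact (leq_addl n k).
have le2 : k.*2 <= n + k by lia.
have := bin_fact le2; have := bin_fact (leq_addr k k).
have -> : n + k - k.*2 = n - k by lia.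
have -> : k + k - k = k by rewrite addnK.
rewrite addnn addnK => e1 e2 e3 e4; apply/eqP.
transitivity ((n + k)`!).
  by rewrite -e3 -e4; ring.
by rewrite -e2 -e1; ring.
Qed.

(** * Congruence arithmetic *)

Lemma eqn_modM d a b a' b' :
  a = a' %[mod d] -> b = b' %[mod d] -> a * b = a' * b' %[mod d].
Proof. by move=> ea eb; rewrite -modnMm ea eb modnMm. Qed.

Lemma eqn_modD d a b a' b' :
  a = a' %[mod d] -> b = b' %[mod d] -> a + b = a' + b' %[mod d].
Proof. by move=> ea eb; rewrite -modnDm ea eb modnDm. Qed.

Lemma eqn_modMl c d a b : a = b %[mod d] -> c * a = c * b %[mod c * d].
Proof. by move=> eab; rewrite -!muln_modr eab. Qed.

Lemma eqn_modMl_odd c a b : odd a = odd b -> c * a = c * b %[mod c * 2].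
Proof. by move=> eab; apply: eqn_modMl; rewrite !modn2 eab. Qed.

(** * Binomial coefficients modulo 2 and 4 *)

Lemma odd_bin_double n k : odd 'C(n.*2, k.*2.+1) = false.
Proof.
have h := mul_bin_diag n.*2 k.*2.
by have := congr1 odd h; rewrite !oddM /= !odd_double.
Qed.

(** Two Pascal steps produce the middle term [2 * 'C(n.*2, k.*2.+1)], a multiple of 4 by
    [odd_bin_double]. *)
Lemma bin_double_mod4 n k : 'C(n.*2, k.*2) = 'C(n, k) %[mod 4].
Proof.
elim: n k => [|n IHn] [|k]; rewrite ?bin0 ?bin0n //.
rewrite !doubleS !binS -!doubleS.
have := IHn k; have := IHn k.+1; have := odd_bin_double n k.
rewrite !doubleS; lia.
Qed.

(** Lucas's theorem for the prime 2, one digit at a time. *)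
Lemma odd_bin (b c : bool) n k :
  odd 'C(b + n.*2, c + k.*2) = (c ==> b) && odd 'C(n, k).
Proof.
have h := bin_double_mod4 n k; have o := odd_bin_double n k.
case: b c => [] [] /=; rewrite ?add0n ?add1n //; last 1 first.
- lia.
- rewrite binS; lia.
case: k h {o} => [|k] h; first by rewrite !bin0.
by rewrite doubleS binS; have o := odd_bin_double n k; rewrite -doubleS; lia.
Qed.

Lemma bin_quad_mod4 (b : bool) n k :
  'C(b + n.*2, k.*2.*2) = 'C(n, k.*2) %[mod 4].
Proof.
case: b; last exact: bin_double_mod4.
have h := bin_double_mod4 n k.*2; rewrite -{}h add1n.
case: (leqP k.*2.*2 n.*2) => [le_kn|lt_nk]; last by rewrite !bin_small //; lia.
(* The factors 2n+1 and 2n+1-4k agree modulo 4 and are odd, so they cancel. *)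
have := mul_bin_down n.*2.+1 k.*2.*2; rewrite -pred_Sn.
move: ('C(_, _)) ('C(_, _)) => x y h.
have [m En] : exists m, n = m + k.*2 by exists (n - k.*2); lia.
have [p [b Em]] : exists p (b : bool), m = b + p.*2.
  by exists m./2, (odd m); rewrite odd_double_half.
case: b Em => Em; subst n m; lia.
Qed.

(** * Central binomial coefficients modulo 4 and 8 *)

Lemma odd_central_bin k : odd 'C(k.*2, k) = (k == 0).
Proof. by case: k => // k; rewrite central_bin_half oddM. Qed.

Lemma central_bin_odd_mod4 k : 0 < k -> 'C(k.*2.+1.*2, k.*2.+1) = 0 %[mod 4].
Proof.
move=> k_gt0; have := odd_bin true false k.*2 k.
rewrite /= odd_central_bin (gtn_eqF k_gt0) central_bin_half add1n add0n; lia.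
Qed.

(* (2k)! = 2^k k! (2k-1)!! makes the ratio of the two sides a quotient of
   products of odd numbers. *)
Lemma central_bin_double_mod8 k :
  'C(k.*2.*2, k.*2) = 3 ^ k * 'C(k.*2, k) %[mod 8].
Proof.
have [D [E [eDE D1 E3]]] : exists D E, [/\ 'C(k.*2.*2, k.*2) * D = 'C(k.*2, k) * E,
    D = 1 %[mod 8] & E = 3 ^ k %[mod 8]].
  elim: k => [|k [D [E [IH D1 E3]]]]; first by exists 1, 1.
  (* The new factor of [E] is (4k+1)(4k+3), written so that its residue 3 modulo 8 is visible; that
     of [D] is an odd square. *)
  exists (D * k.*2.+1 ^ 2), (E * (8 * (2 * k ^ 2 + 2 * k) + 3)); split.
  - have h1 := central_binS k; have h2 := central_binS k.*2.
    have h3 := central_binS k.*2.+1; rewrite -!doubleS in h1 h2 h3 *.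
    move: ('C(_, k.+1)) ('C(_, k.+1.*2)) ('C(_, k.*2.+1)) h1 h2 h3 => x y z.
    move: 'C(_, _) 'C(_, _) IH => c d IH h1 h2 h3.
    have e : k.+1 * y = (4 * k + 3) * z by lia.
    apply/eqP; rewrite -(eqn_pmul2l (ltn0Sn k)); apply/eqP.
    have e1 := congr1 (muln (D * k.*2.+1 ^ 2)) e.
    have e2 := congr1 (muln (D * k.*2.+1 * (4 * k + 3))) h2.
    have e3 := congr1 (muln (k.*2.+1 * (4 * k + 3) * 2 * (4 * k + 1))) IH.
    have e4 := congr1 (muln (E * (4 * k + 3) * (4 * k + 1))) h1.
    lia.
  - rewrite -[1 in RHS]/(1 * 1); apply: eqn_modM => //.
    rewrite -[k]odd_double_half; case: (odd k); move: k./2 => p; lia.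
  - rewrite (expnSr 3); apply: eqn_modM => //; lia.
rewrite -[in LHS](muln1 'C(_, _)).
have -> : 'C(k.*2.*2, k.*2) * 1 = 'C(k.*2.*2, k.*2) * D %[mod 8] by apply: eqn_modM.
by rewrite eDE mulnC; apply: eqn_modM.
Qed.

(** In (4k+1)u = 2(8k+1)z, with u and z the central coefficients at 4k+1 and 4k, 4 divides u and 2
    divides z; hence u = 2z modulo 8, and z is known modulo 4. *)
Lemma central_bin_quad1_mod8 k : 0 < k ->
  'C((k.*2.*2.+1).*2, k.*2.*2.+1) = 2 * 'C(k.*2, k) %[mod 8].
Proof.
move=> k_gt0.
have := central_binS k.*2.*2.
have := @central_bin_odd_mod4 k.*2; rewrite double_gt0 => /(_ k_gt0).
have := bin_double_mod4 k.*2 k; have := bin_double_mod4 k.*2.*2 k.*2.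
have := odd_central_bin k; rewrite (gtn_eqF k_gt0).
move: 'C(_, k) 'C(_, k.*2) 'C(_, k.*2.*2) 'C(_, k.*2.*2.+1) => x y z u.
move=> ox zy yx u4 h.
have [v Ev] : exists v, u = 4 * v by exists (u %/ 4); lia.
have [w Ew] : exists w, z = 2 * w by exists (z %/ 2); lia.
subst u z; nia.
Qed.

(** Up to odd factors this is twice the coefficient at 4k+2, which modulo 4 equals the one at 2k+1,
    hence 0. *)
Lemma central_bin_quad3_mod8 k : 0 < k ->
  'C((k.*2.+1.*2.+1).*2, k.*2.+1.*2.+1) = 0 %[mod 8].
Proof.
move=> k_gt0.
have := central_binS k.*2.+1.*2.
have := central_bin_odd_mod4 k_gt0.
have := bin_double_mod4 k.*2.+1.*2 k.*2.+1.
move: 'C(_, k.*2.+1) 'C(_, k.*2.+1.*2) 'C(_, k.*2.+1.*2.+1) => x y z.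
move=> yx x4 h.
have [w Ew] : exists w, y = 4 * w by exists (y %/ 4); lia.
subst y.
have : 8 %| k.*2.+1.*2.+1 * z by lia.
rewrite Gauss_dvdr => [/eqP //|].
by rewrite (@coprimeXl 3 2) // coprime2n /= odd_double.
Qed.

(** * Term-by-term congruences for large indices *)

Lemma sqr_mod8 a b : a = b %[mod 4] -> a ^ 2 = b ^ 2 %[mod 8].
Proof.
move=> eab; rewrite (divn_eq a 4) (divn_eq b 4) eab.
have : b %% 4 < 4 by rewrite ltn_mod.
move: (a %/ 4) (b %/ 4) (b %% 4) => x y [|[|[|[|r]]]] //= _; lia.
Qed.

Lemma pow3_sqr_mod8 k : (3 ^ k) ^ 2 = 1 %[mod 8].
Proof. by rewrite -expnM mulnC expnM -modnXm exp1n. Qed.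

(** Both central coefficients are even. Squaring brings out a factor 4, leaving squares modulo 8 of
    numbers known modulo 4; the factor 3^k disappears since its square is 1 modulo 8. *)
Lemma apery_term_sqr_double (b : bool) m k : 0 < k ->
  apery_term (b + m.*2) k.*2 ^ 2 = apery_term m k ^ 2 %[mod 32].
Proof.
move=> k_gt0; rewrite /apery_term -addnA -doubleD.
have := bin_quad_mod4 b (m + k) k; have := central_bin_double_mod8 k.
have := odd_central_bin k; rewrite (gtn_eqF k_gt0).
have := odd_central_bin k.*2; rewrite double_eq0 (gtn_eqF k_gt0).
move: 'C(_, k) 'C(_, k.*2) 'C(_, k.*2) => z x' y.
move: 'C(_, _) => x oy oz.
have [w ->] : exists w, z = 2 * w by exists (z %/ 2); lia.
have [v ->] : exists v, y = 2 * v by exists (y %/ 2); lia.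
move=> evw exx'; have {evw} evw : v = 3 ^ k * w %[mod 4] by lia.
have := sqr_mod8 (eqn_modM exx' evw).
have : (x' * (3 ^ k * w)) ^ 2 = (x' * w) ^ 2 %[mod 8].
  rewrite mulnCA expnMn -[in RHS](mul1n (_ ^ 2)); apply: eqn_modM => //.
  exact: pow3_sqr_mod8.
move=> -> e.
have -> : (x * (2 * v)) ^ 2 = 4 * (x * v) ^ 2 by ring.
have -> : (x' * (2 * w)) ^ 2 = 4 * (x' * w) ^ 2 by ring.
exact: (eqn_modMl 4 e).
Qed.

(* Here and below b and c are the two lowest binary digits of n, so b != c says
   that n = 1 or 2 modulo 4. *)
Lemma odd_bin_quad1 (b c : bool) q k :
  odd 'C(b + (c + q.*2).*2 + k.*2.*2.+1, k.*2.*2.+1.*2) =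
    (b != c) && odd 'C(q + k, k.*2).
Proof.
have -> : k.*2.*2.+1.*2 = false + (true + k.*2.*2).*2 by lia.
case: b c => [] [].
- have -> : true + (true + q.*2).*2 + k.*2.*2.+1 = false + (false + (q + k).+1.*2).*2 by lia.
  by rewrite !odd_bin.
- have -> : true + (false + q.*2).*2 + k.*2.*2.+1 = false + (true + (q + k).*2).*2 by lia.
  by rewrite !odd_bin.
- have -> : false + (true + q.*2).*2 + k.*2.*2.+1 = true + (true + (q + k).*2).*2 by lia.
  by rewrite !odd_bin.
- have -> : false + (false + q.*2).*2 + k.*2.*2.+1 = true + (false + (q + k).*2).*2 by lia.
  by rewrite !odd_bin.
Qed.

(** Both sides are multiples of 16, so only a parity has to be compared. *)
Lemma apery_term_sqr_quad1 (b c : bool) q k : 0 < k ->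
  apery_term (b + (c + q.*2).*2) k.*2.*2.+1 ^ 2 =
    (b != c) * 4 * apery_term q k ^ 2 %[mod 32].
Proof.
move=> k_gt0; rewrite /apery_term.
have := odd_bin_quad1 b c q k.
have := central_bin_quad1_mod8 k_gt0.
have := odd_central_bin k; rewrite (gtn_eqF k_gt0).
move: 'C(_, k.*2.*2.+1.*2) 'C(_, k.*2.*2.+1) 'C(_, k.*2) 'C(_, k).
move=> x y x' z oz yz ox.
have [w Ew] : exists w, z = 2 * w by exists (z %/ 2); lia.
have [v Ev] : exists v, y = 4 * v by exists (y %/ 4); lia.
have ov : odd v = odd w by lia.
have e : odd ((x * v) ^ 2) = odd ((b != c) * (x' * w) ^ 2).
  by rewrite oddM !oddX !oddM ox ov oddb -!andbA; case: (b != c).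
have -> : (x * y) ^ 2 = 16 * (x * v) ^ 2 by rewrite Ev; ring.
have -> : (b != c) * 4 * (x' * z) ^ 2 = 16 * ((b != c) * (x' * w) ^ 2) by rewrite Ew; ring.
exact: (eqn_modMl_odd 16 e).
Qed.

Lemma apery_term_quad3 n k : 0 < k ->
  apery_term n k.*2.+1.*2.+1 = 0 %[mod 8].
Proof.
move=> k_gt0; rewrite /apery_term -modnMmr central_bin_quad3_mod8 //.
by rewrite mod0n muln0.
Qed.

(** For odd k > 1 the central coefficients are multiples of 4 and parities suffice. For even k they
    are only even, but 3^k is 1 modulo 8 and the other factors agree modulo 4. At k = 1 neither
    argument applies. *)
Lemma beta_term_double (b : bool) m k : 1 < k ->
  'C(b + m.*2, k.*2) * apery_term (b + m.*2) k.*2 = 'C(m, k) * apery_term m k %[mod 8].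
Proof.
move=> k_gt1; rewrite /apery_term -addnA -doubleD.
have exx := bin_quad_mod4 b (m + k) k; have eyz := central_bin_double_mod8 k.
have [k_odd|k_even] := boolP (odd k).
- have [j Ek] : exists j, k = j.*2.+1 by exists k./2; lia.
  have z4 : 'C(k.*2, k) = 0 %[mod 4] by rewrite Ek central_bin_odd_mod4 //; lia.
  have y4 := bin_double_mod4 k.*2 k.
  have ou : odd 'C(b + m.*2, k.*2) = odd 'C(m, k) by have /= := odd_bin b false m k.
  have o3 : odd (3 ^ k) by rewrite oddX orbT.
  move: 'C(b + (m + k).*2, k.*2.*2) 'C(k.*2.*2, k.*2) 'C(m + k, k.*2)
    'C(k.*2, k) 'C(b + m.*2, k.*2) 'C(m, k) (3 ^ k) exx eyz z4 y4 ou o3.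
  move=> x y x' z u u' t exx eyz z4 y4 ou ot.
  have [w Ew] : exists w, z = 4 * w by exists (z %/ 4); lia.
  have [v Ev] : exists v, y = 4 * v by exists (y %/ 4); lia.
  have ov : odd v = odd w.
    have : odd v = odd (t * w) by rewrite {}Ew {}Ev in eyz; lia.
    by rewrite oddM ot.
  have e : odd (u * (x * v)) = odd (u' * (x' * w)).
    rewrite !oddM ou ov; congr (_ && (_ && _)); lia.
  have -> : u * (x * y) = 4 * (u * (x * v)) by rewrite Ev; ring.
  have -> : u' * (x' * z) = 4 * (u' * (x' * w)) by rewrite Ew; ring.
  exact: (eqn_modMl_odd 4 e).
- have [j Ek] : exists j, k = j.*2 by exists k./2; lia.
  have eu : 'C(b + m.*2, k.*2) = 'C(m, k) %[mod 4] by rewrite Ek bin_quad_mod4.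
  have t1 : 3 ^ k = 1 %[mod 8] by rewrite Ek -muln2 expnM pow3_sqr_mod8.
  have : odd 'C(k.*2, k) = false by rewrite odd_central_bin; lia.
  move: {exx eyz eu}(eqn_modM eu exx) (eqn_modM t1 (erefl ('C(k.*2, k) %% 8))) eyz.
  move: 'C(b + (m + k).*2, k.*2.*2) 'C(k.*2.*2, k.*2) 'C(m + k, k.*2)
    'C(k.*2, k) 'C(b + m.*2, k.*2) 'C(m, k) (3 ^ k) {t1} => x y x' z u u' t.
  rewrite mul1n => exx -> eyz oz.
  have [w Ew] : exists w, z = 2 * w by exists (z %/ 2); lia.
  have [v Ev] : exists v, y = 2 * v by exists (y %/ 2); lia.
  have ev : v = w %[mod 4] by lia.
  have e := eqn_modM exx ev.
  have -> : u * (x * y) = 2 * (u * x * v) by rewrite Ev; ring.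
  have -> : u' * (x' * z) = 2 * (u' * x' * w) by rewrite Ew; ring.
  exact: (eqn_modMl 2 e).
Qed.

(** Both sides are multiples of 4. Oddness of the two binomial factors forces b = 1 and b != c
    respectively. *)
Lemma beta_term_quad1 (b c : bool) q k : 0 < k ->
  'C(b + (c + q.*2).*2, k.*2.*2.+1) * apery_term (b + (c + q.*2).*2) k.*2.*2.+1 =
    (b && ~~ c) * 2 * ('C(q, k) * apery_term q k) %[mod 8].
Proof.
move=> k_gt0; rewrite /apery_term.
have := odd_bin_quad1 b c q k.
have := central_bin_quad1_mod8 k_gt0.
have := odd_bin b true (c + q.*2) k.*2.
have := odd_bin c false q k.
have := odd_central_bin k; rewrite (gtn_eqF k_gt0) add1n add0n /=.
move: 'C(b + (c + q.*2).*2 + _, _) 'C(b + (c + q.*2).*2, k.*2.*2.+1)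
  'C(k.*2.*2.+1.*2, k.*2.*2.+1) 'C(c + q.*2, k.*2) 'C(q, k) 'C(q + k, k.*2) 'C(k.*2, k).
move=> x u y g u' x' z oz -> ou yz ox.
have [w Ew] : exists w, z = 2 * w by exists (z %/ 2); lia.
have [v Ev] : exists v, y = 4 * v by exists (y %/ 4); lia.
have ov : odd v = odd w by lia.
have e : odd (u * (x * v)) = odd ((b && ~~ c) * (u' * (x' * w))).
  rewrite !oddM ox ou ov oddb; move: (odd u') (odd x') (odd w).
  by case: b c {ox ou} => [] [] [] [] [].
have -> : u * (x * y) = 4 * (u * (x * v)) by rewrite Ev; ring.
have -> : (b && ~~ c) * 2 * (u' * (x' * z)) = 4 * ((b && ~~ c) * (u' * (x' * w))).
  by rewrite Ew; ring.
exact: (eqn_modMl_odd 4 e).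
Qed.

(** * Auxiliary facts on small terms and sums *)

Lemma bin2_mod4 p s : 'C(p * 8 + s, 2) = 'C(s, 2) %[mod 4].
Proof.
elim: p => // p; rewrite mulSn -addnA; move: (p * 8 + s) => n <-; rewrite -[8 + n]/(n.+4.+4).
by rewrite !(bin1, binS); lia.
Qed.

Lemma apery_term1 n : apery_term n 1 = n * n.+1.
Proof.
rewrite /apery_term addn1 -[1.*2]/2.
have := mul_bin_diag n.+1 1; rewrite bin1 -[RHS]mulnC -pred_Sn => <-.
exact: mulnC.
Qed.

Lemma sum_split2 (F : nat -> nat) n :
  \sum_(0 <= k < n.*2) F k =
    \sum_(0 <= k < n) F k.*2 + \sum_(0 <= k < n) F k.*2.+1.
Proof.
elim: n => [|n IHn]; first by rewrite !big_geq.
by rewrite doubleS !big_nat_recr //= IHn; lia.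
Qed.

Lemma sum_mod d (F G : nat -> nat) m n :
  (forall k, m <= k -> F k = G k %[mod d]) ->
  \sum_(m <= k < n) F k = \sum_(m <= k < n) G k %[mod d].
Proof.
move=> eFG; rewrite -modn_summ -[RHS]modn_summ; congr (_ %% d).
by apply: eq_big_nat => k /andP[mk _]; apply: eFG.
Qed.

Lemma A_sum n N : n < N -> A n = \sum_(0 <= k < N) apery_term n k ^ 2.
Proof.
move=> lt_nN; rewrite /A (@big_cat_nat _ _ _ n.+1 0 N) //=.
rewrite [X in _ = _ + X]big1_seq ?addn0 => [|k].
  by apply: eq_bigr => k _; rewrite -expnMn bin_mul_apery_term.
by rewrite mem_index_iota => /andP[_ /andP[? _]]; rewrite -bin_mul_apery_term bin_small.
Qed.

Lemma beta_sum n N : n < N ->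
  beta n = \sum_(0 <= k < N) 'C(n, k) * apery_term n k.
Proof.
move=> lt_nN; rewrite /beta (@big_cat_nat _ _ _ n.+1 0 N) //=.
rewrite [X in _ = _ + X]big1_seq ?addn0 => [|k].
  by apply: eq_bigr => k _; rewrite -bin_mul_apery_term mulnA.
by rewrite mem_index_iota => /andP[_ /andP[? _]]; rewrite bin_small.
Qed.

(** * Terms of index 1, 2 and 3 *)

Lemma odd_apery_bin3 (b c : bool) q :
  odd 'C(b + (c + q.*2).*2 + 3, 6) = (b == c) && (b != odd q).
Proof.
(* The binary digits 110 of 6 are exposed for two uses of [odd_bin]. *)
rewrite -[6]/(false + (true + 1.*2).*2).
case: b c => [] [].
- have -> : true + (true + q.*2).*2 + 3 = false + (true + q.+1.*2).*2 by lia.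
  by rewrite !odd_bin bin1 /=; case: (odd q).
- have -> : true + (false + q.*2).*2 + 3 = false + (false + q.+1.*2).*2 by lia.
  by rewrite !odd_bin.
- have -> : false + (true + q.*2).*2 + 3 = true + (false + q.+1.*2).*2 by lia.
  by rewrite !odd_bin.
- have -> : false + (false + q.*2).*2 + 3 = true + (true + q.*2).*2 by lia.
  by rewrite !odd_bin bin1 /=; case: (odd q).
Qed.

(** Replaces [apery_term_sqr_quad1] and [apery_term_quad3] at k = 0. When b = c, the square at index
    3 is 0 or 16 modulo 32 and cancels the one at index 1. *)
Lemma apery_term_sqr_small (b c : bool) q :
  apery_term (b + (c + q.*2).*2) 1 ^ 2 + apery_term (b + (c + q.*2).*2) 3 ^ 2
    = (b != c) * 4 %[mod 32].
Proof.
have := odd_apery_bin3 b c q; rewrite apery_term1 /apery_term -[3.*2]/6.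
have -> : 'C(6, 3) = 20 by []; move: 'C(_, _) => x ox.
have -> : (x * 20) ^ 2 = 16 * (25 * x ^ 2) by ring.
have e : odd (25 * x ^ 2) = odd ((b == c) && (b != odd q)).
  by rewrite oddM oddX ox oddb.
rewrite -modnDmr (eqn_modMl_odd 16 e) modnDmr.
have [p ->] : exists p, q = odd q + p.*2 by exists q./2; rewrite odd_double_half.
rewrite oddD odd_double oddb addbF.
by case: b c (odd q) {ox e} => [] [] []; rewrite /=; lia.
Qed.

(** Collects the low indices outside the termwise lemmas; they produce the correction
    [(b != c) * 4 * odd q] of the recurrence. *)
Lemma beta_term_small (b c : bool) q :
  let n := b + (c + q.*2).*2 in
  'C(n, 1) * apery_term n 1 + 'C(n, 2) * apery_term n 2 + 'C(n, 3) * apery_term n 3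
    = 'C(c + q.*2, 1) * apery_term (c + q.*2) 1
      + (b && ~~ c) * 2 + (b != c) * 4 * odd q %[mod 8].
Proof.
move=> n; rewrite !apery_term1 !bin1 /apery_term -[3.*2]/6 -[2.*2]/4.
have -> : 'C(4, 2) = 6 by []; have -> : 'C(6, 3) = 20 by [].
have o3 : odd ('C(n, 3) * 'C(n + 3, 6) * 5) = odd [&& b, c & ~~ odd q].
  rewrite !oddM odd_apery_bin3 (odd_bin b true _ 1) bin1 oddD odd_double !oddb addbF.
  by case: b c (odd q) {n} => [] [] [].
have -> : 'C(n, 3) * ('C(n + 3, 6) * 20) = 4 * ('C(n, 3) * 'C(n + 3, 6) * 5) by ring.
have e2 : 'C(n + 2, 4) = 'C((c + q.*2).+1, 2) %[mod 4].
  rewrite (_ : n + 2 = b + (c + q.*2).+1.*2); last by rewrite /n; lia.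
  exact: (bin_quad_mod4 b _ 1).
have -> : 'C(n, 2) * ('C(n + 2, 4) * 6) = 2 * (3 * ('C(n, 2) * 'C(n + 2, 4))) by ring.
(* Modulo 4, ['C(_, 2)] has period 8 in its upper argument, so there [q] may be replaced by its
   residue modulo 4. *)
have [p [r [r4 Eq]]] : exists p r, r < 4 /\ q = p * 4 + r.
  by exists (q %/ 4), (q %% 4); rewrite ltn_mod -divn_eq.
have e1 : 'C(n, 2) = 'C(b + (c + r.*2).*2, 2) %[mod 4].
  rewrite -[RHS](bin2_mod4 (p * 2)) /n Eq; congr ('C(_, _) %% _); lia.
have e3 : 'C((c + q.*2).+1, 2) = 'C((c + r.*2).+1, 2) %[mod 4].
  rewrite -[RHS](bin2_mod4 p) Eq; congr ('C(_, _) %% _); lia.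
have e := eqn_modMl 2 (eqn_modM (erefl (3 %% 4)) (eqn_modM e1 (etrans e2 e3))).
rewrite (eqn_modD (eqn_modD (erefl _) e) (eqn_modMl_odd 4 o3)) /n Eq.
rewrite oddD oddM andbF /=.
by case: b c r r4 {n o3 e1 e2 e3 e Eq} => [] [] [|[|[|[|r]]]] // _;
  rewrite ?bin2 /=; lia.
Qed.

(** * Recurrences for A and beta *)

Lemma apery_term0 n : apery_term n 0 = 1.
Proof. by rewrite /apery_term !bin0. Qed.

Lemma A_mod32_rec (b c : bool) q :
  A (b + (c + q.*2).*2) = A (c + q.*2) + (b != c) * 4 * A q %[mod 32].
Proof.
(* Padding the three sums with zero terms to lengths q+1, 2(q+1) and 4(q+1) makes them align when
   indices are split modulo 4. *)
have lq := ltnSn q; have lm : c + q.*2 < q.+1.*2 by lia.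
have ln : b + (c + q.*2).*2 < q.+1.*2.*2 by lia.
rewrite (A_sum ln) sum_split2 [X in _ + X]sum_split2 -big_split.
rewrite (A_sum lm) (A_sum lq) big_distrr /=.
apply: eqn_modD; apply: sum_mod => -[|k] _.
- by rewrite !apery_term0.
- exact: apery_term_sqr_double.
- by rewrite apery_term0 exp1n muln1 apery_term_sqr_small.
- rewrite -[RHS]/(_ %% 32) -[in RHS](addn0 (_ * _)); apply: eqn_modD.
    exact: apery_term_sqr_quad1.
  have := apery_term_quad3 (b + (c + q.*2).*2) (ltn0Sn k).
  move: (apery_term _ _) => x x8.
  have -> : x = 8 * (x %/ 8) by lia.
  move: (x %/ 8) => y; lia.
Qed.

Lemma beta_mod8_rec (b c : bool) q :
  beta (b + (c + q.*2).*2) =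
    beta (c + q.*2) + (b && ~~ c) * 2 * beta q + (b != c) * 4 * odd q %[mod 8].
Proof.
have lq := ltnSn q; have lm : c + q.*2 < q.+1.*2 by lia.
have ln : b + (c + q.*2).*2 < q.+1.*2.*2 by lia.
have small := beta_term_small b c q.
rewrite (beta_sum ln) sum_split2 [X in _ + X]sum_split2 -big_split.
rewrite (beta_sum lm) (beta_sum lq) doubleS /=.
have := @beta_term_double b (c + q.*2); have := beta_term_quad1 b c q.
move=> quad1 double.
(* Indices 0 to 3 of the sum for n are isolated, along with 0 and 1 of the sum for n/2 and 0 of that
   for n/4. *)
rewrite (@big_ltn _ _ _ 0 q.*2.+2) // (@big_ltn _ _ _ 1 q.*2.+2) //.
rewrite (@big_ltn _ _ _ 0 q.+1) // (@big_ltn _ _ _ 0 q.*2.+2) // (@big_ltn _ _ _ 1 q.*2.+2) //.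
rewrite (@big_ltn _ _ _ 0 q.+1) //.
have S1 := sum_mod q.*2.+2 double.
have S2 : \sum_(1 <= k < q.+1) ('C(b + (c + q.*2).*2, k.*2.*2.+1) *
       apery_term (b + (c + q.*2).*2) k.*2.*2.+1 +
       'C(b + (c + q.*2).*2, k.*2.+1.*2.+1) *
       apery_term (b + (c + q.*2).*2) k.*2.+1.*2.+1)
    = (b && ~~ c) * 2 * \sum_(1 <= k < q.+1) 'C(q, k) * apery_term q k %[mod 8].
  rewrite big_distrr /=; apply: sum_mod => k k_gt0.
  rewrite -modnDmr -modnMmr apery_term_quad3 // mod0n muln0 mod0n addn0.
  exact: quad1.
rewrite -[1.*2]/2 -[0.*2.*2.+1]/1 -[0.*2.+1.*2.+1]/3 -[0.*2]/0 !bin0 !apery_term0 mulnDr.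
move: small S1 S2; rewrite /=.
move: (\sum_(_ <= _ < _) _) (_ * \sum_(_ <= _ < _) _) (\sum_(_ <= _ < _) _) (\sum_(_ <= _ < _) _).
move: ('C(_, 1) * _) ('C(_, 1) * _) ('C(_, 2) * _) ('C(_, 3) * _) ((b != c) * 4 * _).
move=> *; lia.
Qed.

(** * Induction on the binary expansion and elimination of X *)

Lemma apery_mod_L2 n : exists X,
  [/\ A n = 1 + 4 * L2 n + 16 * X %[mod 32],
      beta n = 1 + 2 * ((L2 n %% 4 == 1) || (L2 n %% 4 == 2)) + 4 * X %[mod 8]
    & odd (L2 n) = odd n].
Proof.
elim/ltn_ind: n => n IHn; have [->|n_gt0] := posnP n.
  by exists 0; rewrite /A /beta !big_nat1.
have [b [c [q En]]] : exists (b c : bool) q, n = b + (c + q.*2).*2.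
  by exists (odd n), (odd n./2), n./2./2; rewrite !odd_double_half.
have [|X [eA eB oL]] := IHn (c + q.*2); first by lia.
have [|Y [fA fB oM]] := IHn q; first by lia.
(* Modulo 32, 4 A_q is 4 + 16 L2(q), and L2(q) has the parity of q by the third invariant; this is
   the extra multiple of 16. *)
exists (X + (b != c) * odd q).
have Lm := L2_double c q; have Ln := L2_double b (c + q.*2).
have := A_mod32_rec b c q; have := beta_mod8_rec b c q; rewrite -En.
rewrite -En oddD odd_double addbF oddb in Ln.
have on : odd n = b by rewrite En oddD odd_double addbF oddb.
move: (A n) (A q) (A (c + _)) (beta n) (beta q) (beta (c + _)) (L2 n) (L2 q) (L2 (c + _))
  eA eB oL fA fB oM Lm Ln => An Aq Am Bn Bq Bm l lq lm.
move=> eA eB oL fA fB oM Lm Ln hB hA; rewrite on.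
(* The three run-lengths become 4u plus small numbers, so finitely many cases of digits and [s]
   remain. *)
have [u [s [s4 Eq]]] : exists u s, s < 4 /\ lq = 4 * u + s.
  by exists (lq %/ 4), (lq %% 4); rewrite ltn_mod mulnC -divn_eq.
have os : odd s = odd q by rewrite -oM Eq oddD oddM.
move: (odd q) Lm hB os {En on oM} => e Lm hB os.
have El : l = 4 * u + (s + (c != e) + (b != c)) by rewrite Ln Lm Eq !addnA.
have Em : lm = 4 * u + (s + (c != e)) by rewrite Lm Eq addnA.
rewrite {}Em in eA eB {oL Lm Ln}; rewrite {}Eq in fA fB; rewrite {}El.
have mod4 x : (4 * u + x) %% 4 = x %% 4 by rewrite mulnC modnMDl.
rewrite !mod4 in eB fB *.
case: b c e s s4 hA hB os eA eB fA fB => [] [] [] [|[|[|[|s]]]] // _ hA hB os eA eB fA fB.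
all: rewrite /= ?muln0 ?mul0n ?mul1n ?muln1 ?addn0 in hA hB os eA eB fA fB *; try discriminate os.
all: clear -hA hB eA eB fA fB.
all: split; lia.
Qed.

Theorem theorem1p4 (n i j k l m : nat)
    (hi : i < 2) (hj : j < 2) (hk : k < 2) (hl : l < 2) (hm : m < 2)
    (hA : A n = 16 * k + 8 * j + 4 * i + 1 %[mod 32])
    (hbeta : beta n = 4 * m + 2 * l + 1 %[mod 8]) :
  L2 n = 4 * (k + m) + 2 * j + i %[mod 8].
Proof.
have [X [eA eB _]] := apery_mod_L2 n; move: eA eB; rewrite hA hbeta.
move: (L2 n) ((L2 n %% 4 == 1) || _) => L r eA eB.
(* Comparison modulo 4 forces l = r. Then the congruence for A gives L + 4X = 4k + 2j + i modulo 8,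
   where -4X and 4m agree. *)
have mX : m = X %[mod 2] by case: r eB => eB; lia.
lia.
Qed.
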